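(* Let $K,L\in\mathcal{S}_0$. (i) Let $\phi_1,\phi_2\in\tilde{\Phi}_1$ be such that the left derivative $\phi_{1,l}'(1)$ of $\phi_1$ at $1$ exists and is finite. Then $$\phi_{1,l}'(1)\lim_{\epsilon\to0^+}\frac{|K|-|K\widetilde{+}_{\epsilon,\phi_1,\phi_2}L|}{n\epsilon}=\frac1n\int_{S^{n-1}}\phi_2\bigg(\frac{\rho_K(u)}{\rho_L(u)}\bigg)[\rho_K(u)]^n\,d\sigma(u).$$ (ii) Let $\phi_1,\phi_2\in\tilde{\Psi}_1$ be such that the right derivative $\phi_{1,r}'(1)$ of $\phi_1$ at $1$ exists and is finite. Then $$\phi_{1,r}'(1)\lim_{\epsilon\to0^+}\frac{|K|-|K\widetilde{+}_{\epsilon,\phi_1,\phi_2}L|}{n\epsilon}=\frac1n\int_{S^{n-1}}\phi_2\bigg(\frac{\rho_K(u)}{\rho_L(u)}\bigg)[\rho_K(u)]^n\,d\sigma(u).$$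
   Context: Fix a positive integer $n$. A star body (about the origin) is a set $K\subset\mathbb{R}^n$ that contains the segment from the origin to each of its points and whose radial function $\rho_K(u)=\max\{\lambda:\lambda u\in K\}$, $u\in S^{n-1}$, is continuous and positive on $S^{n-1}$. $\mathcal{S}_0$ is the set of all star bodies; a star body is uniquely determined by its (continuous positive) radial function and vice versa. $|K|$ denotes volume and $\sigma$ is the spherical measure on the unit sphere $S^{n-1}$. $\tilde{\Phi}_1$ is the set of continuous strictly increasing functions $\phi:[0,\infty)\to[0,\infty)$ with $\phi(0)=0$ and $\phi(1)=1$. $\tilde{\Psi}_1$ is the set of functions $\phi:(0,\infty)\to(0,\infty)$ such that $t\mapsto\phi(1/t)$ belongs to $\tilde{\Phi}_1$ (i.e. extends continuously from $(0,\infty)$ to $[0,\infty)$ as an element of $\tilde{\Phi}_1$). For $\phi_1,\phi_2$ either both in $\tilde{\Phi}_1$ or both in $\tilde{\Psi}_1$, $\epsilon>0$ and $K,L\in\mathcal{S}_0$, the star body $K\widetilde{+}_{\epsilon,\phi_1,\phi_2}L\in\mathcal{S}_0$ is the one whose radial function is uniquely determined by $$1=\phi_1\bigg(\frac{\rho_{K\widetilde{+}_{\epsilon,\phi_1,\phi_2}L}(u)}{\rho_K(u)}\bigg)+\epsilon\,\phi_2\bigg(\frac{\rho_{K\widetilde{+}_{\epsilon,\phi_1,\phi_2}L}(u)}{\rho_L(u)}\bigg)\quad\text{for all }u\in S^{n-1}.$$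
   Formalization: The one-sided derivative of φ₁ at 1 is assumed to be nonzero; when it is 0 the limit is infinite (e.g. φ₁(t)=t(2−t) on [0,1]) and the displayed identity would read 0·∞ = a positive number. *)

(* Defs.v *)
From HB Require Import structures.
From mathcomp Require Import all_boot all_order all_algebra.
From mathcomp Require Import all_classical all_reals all_analysis.

Set Implicit Arguments.
Unset Strict Implicit.
Unset Printing Implicit Defensive.

Import Order.TTheory GRing.Theory Num.Theory.
Import numFieldNormedType.Exports.

Local Open Scope classical_set_scope.
Local Open Scope ring_scope.

Section StarBodies.
Context {R : realType} {n : nat}.

(* The library norm `|x| on 'rV[R]_n is the sup norm. *)
Definition enorm (x : 'rV[R]_n) : R := Num.sqrt (\sum_(i < n) x 0 i ^+ 2).

Definition sphere : set 'rV[R]_n := [set u | enorm u = 1].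

Definition radial (K : set 'rV[R]_n) (u : 'rV[R]_n) : R :=
  sup [set l : R | K (l *: u)].

(* The third clause says that the supremum defining [radial K u] is a
   maximum. *)
Definition star_body (K : set 'rV[R]_n) : Prop :=
  [/\ forall x t, K x -> 0 <= t <= 1 -> K (t *: x),
      forall u, sphere u -> 0 < radial K u,
      forall u, sphere u ->
        K (radial K u *: u) /\ (forall l, K (l *: u) -> l <= radial K u)
    & {within sphere, continuous (radial K)}].

(* For eps > 0, star bodies K and L, and phi1, phi2 both in [Phi1] or both in
   [Psi1], exactly one M satisfies the condition, so that the default [set0] is
   not used. *)
Definition orlicz_sum (eps : R) (phi1 phi2 : R -> R) (K L : set 'rV[R]_n)
    : set 'rV[R]_n :=
  xget set0 [set M | star_body M /\
    forall u, sphere u ->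
      1 = phi1 (radial M u / radial K u) + eps * phi2 (radial M u / radial L u)].

(* A box of R^n is given by its pair of extreme vertices, the lower one first. *)
Definition in_box (b : 'rV[R]_n * 'rV[R]_n) : set 'rV[R]_n :=
  [set x | forall i, b.1 0 i <= x 0 i <= b.2 0 i].

Definition box_volume (b : 'rV[R]_n * 'rV[R]_n) : R :=
  \prod_(i < n) (b.2 0 i - b.1 0 i).

(* n-dimensional Lebesgue outer measure; it is countably additive on Borel
   sets by [borel_caratheodory] below. *)
Definition lebesgue_rV (A : set 'rV[R]_n) : \bar R :=
  ereal_inf [set (\sum_(0 <= k <oo) (box_volume (B k))%:E)%E
    | B in [set B : nat -> 'rV[R]_n * 'rV[R]_n |
        (forall k i, (B k).1 0 i <= (B k).2 0 i) /\
        A `<=` \bigcup_k in_box (B k)]].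

Definition volume (A : set 'rV[R]_n) : R := fine (lebesgue_rV A).

Definition borel_rV := g_sigma_algebraType (@open 'rV[R]_n).

Definition cone (A : set 'rV[R]_n) : set 'rV[R]_n :=
  [set x | exists t u, [/\ 0 < t <= 1, sphere u, A u & x = t *: u]].

(* Spherical Lebesgue measure: sigma(A) is n times the volume of the cone
   over A with apex at the origin.  It is seen as a Borel measure on R^n
   carried by the sphere. *)
Definition sphere_measure (A : set borel_rV) : \bar R :=
  (n%:R%:E * lebesgue_rV (cone A))%E.

End StarBodies.

Section OrliczFunctions.
Context {R : realType}.

(* Only the restriction of phi to [0, +oo[ is meaningful. *)
Definition Phi1 (phi : R -> R) : Prop :=
  [/\ forall t, 0 <= t -> 0 <= phi t,
      {within `[0, +oo[, continuous phi},
      forall s t, 0 <= s -> s < t -> phi s < phi t,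
      phi 0 = 0 & phi 1 = 1].

(* Only the restriction of phi to ]0, +oo[ is meaningful. *)
Definition Psi1 (phi : R -> R) : Prop :=
  (forall t, 0 < t -> 0 < phi t) /\
  exists2 psi, Phi1 psi & forall t, 0 < t -> psi t = phi t^-1.

Definition is_left_derivative (f : R -> R) (x d : R) : Prop :=
  (f t - f x) / (t - x) @[t --> x^'-] --> d.

Definition is_right_derivative (f : R -> R) (x d : R) : Prop :=
  (f t - f x) / (t - x) @[t --> x^'+] --> d.

End OrliczFunctions.

Section OuterMeasure.
Local Open Scope ereal_scope.
Context {R : realType} {n : nat}.
Local Notation rV := 'rV[R]_n.+1.
Local Notation mu := (@lebesgue_rV R n.+1).

Let wf (b : rV * rV) := forall i, (b.1 ord0 i <= b.2 ord0 i)%R.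

Let box_volume_ge0 b : wf b -> 0 <= (box_volume b)%:E.
Proof. by move=> wb; rewrite lee_fin prodr_ge0// => i _; rewrite subr_ge0. Qed.

Let mu_ge0 A : 0 <= mu A.
Proof.
apply: le_ereal_inf_tmp => x [B [wB AB] <-{x}].
by apply: nneseries_ge0 => k _ _; exact/box_volume_ge0/wB.
Qed.

Let mu0 : mu set0 = 0.
Proof.
apply/eqP; rewrite eq_le mu_ge0 andbT; apply: ereal_inf_lbound.
exists (fun=> (0%R, 0%R)) => /=; first by split.
rewrite eseries0// => k _ _; congr (_%:E).
by rewrite /box_volume (bigD1 ord0)//= !mxE subrr mul0r.
Qed.

Let le_mu : {homo mu : A B / A `<=` B >-> A <= B}.
Proof.
move=> A B AB; apply/ereal_inf_le_tmp => x [C [wC BC] <-{x}].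
by exists C => //; split => //; apply: subset_trans AB BC.
Qed.

Let mu_sigma_subadditive : sigma_subadditive mu.
Proof.
move=> A; have [[i ioo]|] := pselect (exists i, mu (A i) = +oo).
  rewrite (eseries_pinfty _ _ ioo) ?leey// => k _.
  by rewrite -ltNye (lt_le_trans _ (mu_ge0 _)).
rewrite -forallNE => Aoo.
apply/lee_addgt0Pr => _/posnumP[e].
rewrite (le_trans _ (epsilon_trick _ _ _))//.
pose P k (B : nat -> rV * rV) := [/\ forall j, wf (B j),
  A k `<=` \bigcup_j in_box (B j) &
  \sum_(j <oo) (box_volume (B j))%:E <= mu (A k) + (e%:num / (2 ^ k.+1)%:R)%:E].
have [G PG] : {G & forall k, P k (G k)}.
  apply: (@choice _ _ P) => k.
  have : mu (A k) \is a fin_num.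
    by rewrite ge0_fin_numE// ltey; apply/eqP; exact: Aoo.
  have ek : (0 < e%:num / (2 ^ k.+1)%:R)%R by [].
  move=> /(lb_ereal_inf_adherent ek)[x [B [wB AB] <-] lex].
  by exists B; split => //; exact/ltW.
pose v (ij : nat * nat) := (box_volume (G ij.1 ij.2))%:E.
have v_ge0 x : 0 <= v x by have [wG _ _] := PG x.1; exact/box_volume_ge0/wG.
apply: (@le_trans _ _ (\esum_(i in setT) v i)).
  apply: ereal_inf_lbound => /=.
  have /card_esym/ppcard_eqP[f] := card_nat2.
  exists (fun k => G (f k).1 (f k).2).
    split => [k|x [i _ Aix]]; first by have [wG _ _] := PG (f k).1; exact: wG.
    have [_ /(_ _ Aix)[j _ Gijx] _] := PG i.
    by exists (f^-1%FUN (i, j)) => //=; rewrite invK ?inE.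
  rewrite [LHS](_ : _ = \sum_(0 <= k <oo) (v \o f) k)//.
  rewrite -(esum_pred_image v _ xpredT) ?[fun=> _]set_true//.
  by rewrite image_eq.
rewrite (_ : esum _ _ = \sum_(i <oo) \sum_(j <oo ) v (i, j)); last first.
  pose J : nat -> set (nat * nat) := fun i => [set (i, j) | j in setT].
  rewrite (_ : setT = \bigcup_k J k); last first.
    by rewrite predeqE => -[a b]; split => // _; exists a => //; exists b.
  rewrite esum_bigcupT /=; last 2 first.
    - apply/trivIsetP => i j _ _ ij.
      rewrite predeqE => -[k m] /=; split => //= -[] [_] _ [<-{k} _].
      by move=> [m' _] [] /esym/eqP; rewrite (negbTE ij).
    - by [].
  rewrite -(image_id [set: nat]) -fun_true esum_pred_image//; last first.
    by move=> k _; exact: esum_ge0.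
  apply: eq_eseriesr => /= j _.
  rewrite -(esum_pred_image v (pair j) predT)//=; last first.
    by move=> ? ? _ _; exact: (@can_inj _ _ _ snd).
  by congr esum; rewrite predeqE => -[a b]; split; move=> [i _ <-]; exists i.
apply: lee_nneseries => [k _ _|k _]; first exact: nneseries_ge0.
by have [_ _] := PG k.
Qed.

HB.instance Definition _ := isOuterMeasure.Build R rV mu
  mu0 mu_ge0 le_mu mu_sigma_subadditive.

Let cut_lo (i : 'I_n.+1) (c : R) (b : rV * rV) : rV * rV :=
  (b.1, \row_j if j == i then Num.max (b.1 ord0 i) (Num.min (b.2 ord0 i) c)
               else b.2 ord0 j).
Let cut_hi (i : 'I_n.+1) (c : R) (b : rV * rV) : rV * rV :=
  (\row_j if j == i then Num.min (b.2 ord0 i) (Num.max (b.1 ord0 i) c)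
          else b.1 ord0 j, b.2).

Let half_cara (i : 'I_n.+1) (c : R) :
  mu.-caratheodory [set x : rV | (x ord0 i <= c)%R].
Proof.
apply: le_caratheodory_measurable => X.
apply: le_ereal_inf_tmp => _ [B [wB XB] <-].
have wlo k : wf (cut_lo i c (B k)).
  by move=> j; rewrite /= mxE; case: eqP => [->|_]; rewrite ?le_max ?lexx.
have whi k : wf (cut_hi i c (B k)).
  by move=> j; rewrite /= mxE; case: eqP => [->|_]; rewrite ?ge_min ?lexx.
have -> : \sum_(0 <= k <oo) (box_volume (B k))%:E =
    \sum_(0 <= k <oo) (box_volume (cut_lo i c (B k)))%:E +
    \sum_(0 <= k <oo) (box_volume (cut_hi i c (B k)))%:E.
  rewrite -nneseriesD; last 2 first.
  - by move=> k _ _; exact/box_volume_ge0/wlo.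
  - by move=> k _ _; exact/box_volume_ge0/whi.
  apply: eq_eseriesr => k _; rewrite -EFinD; congr (_%:E).
  rewrite /box_volume [LHS](bigD1 i)//= [X in (_ = X + _)%R](bigD1 i)//=.
  rewrite [X in (_ = _ + X)%R](bigD1 i)//= !mxE eqxx.
  under [X in (_ = _ * X + _)%R]eq_bigr => j /negbTE ji do rewrite mxE ji.
  under [X in (_ = _ + _ * X)%R]eq_bigr => j /negbTE ji do rewrite mxE ji.
  rewrite -mulrDl; congr (_ * _)%R; have := wB k i.
  move: ((B k).1 ord0 i) ((B k).2 ord0 i) => a b ab.
  have [bc|cb] := leP b c; have [ac|ca] := leP a c.
  - by rewrite (max_idPr ab) (min_idPl bc) subrr addr0.
  - by have := lt_le_trans ca (le_trans ab bc); rewrite ltxx.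
  - by rewrite (min_idPr (ltW cb)) [RHS]addrC addrA subrK.
  - by rewrite (min_idPr ab) subrr add0r.
apply: leeD.
- apply: ereal_inf_lbound; exists (fun k => cut_lo i c (B k)) => //.
  split => // x [/XB[k _ Bkx] /= xc]; exists k => // j.
  have := Bkx j; rewrite /= mxE => /andP[-> jx]/=.
  by case: eqP => // ji; rewrite le_max -ji le_min jx ji xc orbT.
- apply: ereal_inf_lbound; exists (fun k => cut_hi i c (B k)) => //.
  split => // x [/XB[k _ Bkx] /= /negP]; rewrite -ltNge => /ltW xc.
  exists k => // j; have := Bkx j; rewrite /= mxE => /andP[jx ->]/=.
  rewrite andbT; case: eqP => // ji.
  by rewrite ge_min -ji ge_max jx ji xc orbT.
Qed.

Let open_cara (U : set rV) : open U -> mu.-caratheodory U.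
Proof.
move=> oU; change (measurable (U : set (caratheodory_type mu))).
pose box (pq : 'rV[rat]_n.+1 * 'rV[rat]_n.+1) : set rV :=
  [set x | forall i, (ratr (pq.1 ord0 i) < x ord0 i <= ratr (pq.2 ord0 i))%R].
have mbox pq : measurable (box pq : set (caratheodory_type mu)).
  rewrite (_ : box pq = \bigcap_(i in [set: 'I_n.+1])
      ([set x : rV | (x ord0 i <= ratr (pq.2 ord0 i))%R] `\`
       [set x : rV | (x ord0 i <= ratr (pq.1 ord0 i))%R])).
    apply: fin_bigcap_measurable => // i _.
    by apply: (@measurableD _ (caratheodory_type mu)); exact: half_cara.
  apply/seteqP; split=> [x bx i _|x bx i].
    by have /andP[px qx] := bx i; split => //=; apply/negP; rewrite -ltNge.
  by have [/= -> /negP] := bx i I; rewrite -ltNge => ->.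
have -> : U = \bigcup_pq (if `[< box pq `<=` U >] then box pq else set0).
  apply/seteqP; split=> [x Ux|x [pq _]]; last first.
    by case: ifPn => // /asboolP; exact.
  have /nbhs_ballP[e e0 xeU] : nbhs x U by move: oU; rewrite openE; exact.
  have [p pP] : {p : 'I_n.+1 -> rat & forall i,
      ratr (p i) \in `]x ord0 i - e, x ord0 i[%R}.
    apply: (@choice _ _ (fun i q => ratr q \in `]x ord0 i - e, x ord0 i[%R)).
    by move=> i; apply: rat_in_itvoo; rewrite ltrBlDr ltrDl.
  have [q qP] : {q : 'I_n.+1 -> rat & forall i,
      ratr (q i) \in `]x ord0 i, x ord0 i + e[%R}.
    apply: (@choice _ _ (fun i q => ratr q \in `]x ord0 i, x ord0 i + e[%R)).
    by move=> i; apply: rat_in_itvoo; rewrite ltrDl.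
  exists (\row_i p i, \row_i q i) => //; rewrite asboolT => [i|y ypq].
    rewrite /= !mxE; have := pP i; have := qP i.
    by rewrite !in_itv/= => /andP[/ltW -> _] /andP[_ ->].
  apply: xeU; split=> // i j; rewrite (ord1 i); have := ypq j; rewrite /= !mxE.
  have := pP j; have := qP j; rewrite !in_itv/= => /andP[_ qe] /andP[pe _].
  move=> /andP[py yq]; rewrite /ball/= ltr_distlC.
  by rewrite (lt_trans pe py) (le_lt_trans yq qe).
apply: (@countable_bigcupT_measurable _ (caratheodory_type mu)) => [|pq].
  exact: countableP.
by case: ifPn => // _; exact: measurable0.
Qed.

Lemma borel_caratheodory (A : set rV) :
  measurable (A : set (@borel_rV R n.+1)) -> mu.-caratheodory A.
Proof.
apply: smallest_sub; last by move=> U; exact: open_cara.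
have [m0 mC mU] := sigma_algebra_measurable (caratheodory_type mu).
by split => // B mB; have := mC _ mB.
Qed.

End OuterMeasure.

Section SphereMeasure.
Context {R : realType} {n : nat}.
Local Notation rV := 'rV[R]_n.+1.
Local Notation mu := (@lebesgue_rV R n.+1).

Let enormZ t (x : rV) : enorm (t *: x) = `|t| * enorm x.
Proof.
rewrite /enorm -(sqrtr_sqr t) -sqrtrM ?sqr_ge0// mulr_sumr.
by congr Num.sqrt; apply: eq_bigr => i _; rewrite mxE exprMn.
Qed.

Let enorm_continuous : continuous (@enorm R n.+1).
Proof.
have sq : continuous (fun x : rV => \sum_(i < n.+1) x ord0 i ^+ 2).
  apply: (@continuous_big R _ +%R 0 _ _ rV) => [|i _ x].
    exact: (@add_continuous R^o).
  apply: (@continuous_comp rV R R (fun y : rV => y ord0 i) (@GRing.exp R ^~ 2)).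
    exact: coord_continuous.
  exact: exprn_continuous.
move=> x; apply: (@continuous_comp rV R R _ (@Num.sqrt R)); first exact: sq.
exact: sqrt_continuous.
Qed.

Let coneE (A : set rV) :
  cone A = [set x | 0 < enorm x <= 1 /\ A ((enorm x)^-1 *: x)].
Proof.
apply/seteqP; split=> x /= [].
  move=> t [u [/andP[t0 t1] u1 Au ->]].
  have -> : enorm (t *: u) = t by rewrite enormZ u1 mulr1 gtr0_norm.
  by rewrite t0 t1 scalerA mulVf ?gt_eqF// scale1r.
move=> /andP[x0 x1] Ax; exists (enorm x), ((enorm x)^-1 *: x).
rewrite x0 x1; split => //.
  by rewrite /sphere/= enormZ gtr0_norm ?invr_gt0// mulVf// gt_eqF.
by rewrite scalerA divff ?scale1r// gt_eqF.
Qed.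

Let coneT_measurable : measurable (cone setT : set (@borel_rV R n.+1)).
Proof.
rewrite coneE [X in measurable X](_ : _ =
  (@enorm R n.+1 @^-1` [set x | 0 < x]) `\`
  (@enorm R n.+1 @^-1` [set x | 1 < x])); last first.
  apply/seteqP; split=> x /=.
    by move=> [/andP[-> x1] _]; split => //; apply/negP; rewrite -leNgt.
  by move=> [-> /negP]; rewrite -leNgt => ->.
apply: measurableD; apply: sub_sigma_algebra; by apply: open_comp => //; exact: open_gt.
Qed.

Lemma cone_measurable (A : set (@borel_rV R n.+1)) :
  measurable A -> measurable (cone A : set (@borel_rV R n.+1)).
Proof.
move: A; apply: smallest_sub => [|U oU].
  split=> [|A mA|F mF] /=.
  - by rewrite (_ : cone set0 = set0) ?coneE//; apply/seteqP; split=> x [].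
  - rewrite (_ : cone _ = cone setT `\` cone A); first exact: measurableD.
    rewrite !coneE; apply/seteqP; split=> x /=; first by move=> [? [_ ?]]; tauto.
    by move=> [[x1 _] Ax]; split => //; split => // ?; exact: Ax.
  - rewrite (_ : cone _ = \bigcup_k cone (F k)); first exact: bigcupT_measurable.
    apply/seteqP; split=> x /=.
      by rewrite coneE => -[x1 [k _ Fx]]; exists k => //; rewrite coneE.
    by move=> [k _]; rewrite !coneE => -[x1 Fx]; split => //; exists k.
rewrite /= (_ : cone U = cone setT `&`
  [set x | 0 < enorm x /\ U ((enorm x)^-1 *: x)]); last first.
  rewrite !coneE; apply/seteqP; split=> x /=.
    by move=> [/andP[x0 x1] Ux]; rewrite x0 x1.
  by move=> [[? _] [_ ?]].
apply: measurableI => //; apply: sub_sigma_algebra.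
rewrite openE => x [x0 Ux].
have cx : {for x, continuous (fun y : rV => (enorm y)^-1 *: y)}.
  apply: continuousZ => //; apply: continuousV; first by rewrite gt_eqF.
  exact: enorm_continuous.
near=> y; split.
- near: y; apply: (@enorm_continuous x [set t | 0 < t]).
  by apply: open_nbhs_nbhs; split => //; exact: open_gt.
- near: y; apply: cx; exact: open_nbhs_nbhs.
Unshelve. all: by end_near. Qed.

Local Open Scope ereal_scope.

Let sigma0 : sphere_measure (set0 : set (@borel_rV R n.+1)) = 0.
Proof.
rewrite /sphere_measure (_ : cone set0 = set0) ?outer_measure0 ?mule0//.
by rewrite coneE; apply/seteqP; split=> x [].
Qed.

Let sigma_ge0 (A : set (@borel_rV R n.+1)) : 0 <= sphere_measure A.
Proof. by rewrite mule_ge0// outer_measure_ge0. Qed.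

Let sigma_additive : semi_sigma_additive (@sphere_measure R n.+1).
Proof.
move=> F mF tF mUF.
have cara (A : set (@borel_rV R n.+1)) : measurable A -> mu.-caratheodory (cone A).
  by move=> mA; apply: borel_caratheodory; exact: cone_measurable.
have UF : cone (\bigcup_k F k) = \bigcup_k cone (F k).
  apply/seteqP; split=> x /=.
    by rewrite coneE => -[x1 [k _ Fx]]; exists k => //; rewrite coneE.
  by move=> [k _]; rewrite !coneE => -[x1 Fx]; split => //; exists k.
have tcF : trivIset setT (fun k => cone (F k)).
  apply/trivIsetP => i j _ _ ij; rewrite !coneE -subset0 => x /= [[_ Fi] [_ Fj]].
  move/trivIsetP : tF => /(_ i j I I ij); rewrite -subset0; apply.
  by split; [exact: Fi|].
have := @caratheodory_measure_sigma_additive _ _ mu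
  (fun k => cone (F k)) (fun k => cara _ (mF k)) tcF.
rewrite -UF => /(_ (cara _ mUF)) cvgF.
rewrite [X in X @ _ --> _](_ : _ = fun k =>
    n.+1%:R%:E * \sum_(0 <= i < k) mu (cone (F i))); first exact: cvgeZl.
apply/funext => k; rewrite ge0_sume_distrr// => i _.
exact: outer_measure_ge0.
Qed.

HB.instance Definition _ := isMeasure.Build _ (@borel_rV R n.+1) R
  (@sphere_measure R n.+1) sigma0 sigma_ge0 sigma_additive.

End SphereMeasure.

(* Main.v *)
(** Cutting the sphere into the pieces where the radial function lies in
    [[m q^k, m q^(k+1)[] and comparing with dilated cones shows that [n |M|] and
    the integral of [rho_M ^ n] over the sphere agree up to a factor [q ^ n],
    for every [q > 1]; hence they are equal.  With [t = rho_M / rho_K] and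
    [1 - phi1 t = eps * phi2 (rho_M / rho_L)],
      [(rho_K ^ n - rho_M ^ n) / eps =
       rho_K ^ n * ((1 - t ^ n) / (1 - phi1 t)) * phi2 (rho_M / rho_L)],
    where [t] tends to 1 uniformly on the sphere, from the left for [Phi1] and
    from the right for [Psi1], so that the middle factor tends to [n / d].
    Dominated convergence concludes.  For [Psi1], the equation defining the sum
    becomes one of type [Phi1] in the unknown [1 / rho_M]. *)

Require Import Defs.
From mathcomp Require Import all_boot all_order all_algebra.
From mathcomp Require Import all_classical all_reals all_analysis.
From mathcomp Require Import measurable_realfun.

Set Implicit Arguments.
Unset Strict Implicit.
Unset Printing Implicit Defensive.

Import Order.TTheory GRing.Theory Num.Theory.
Import numFieldNormedType.Exports.

Local Open Scope classical_set_scope.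
Local Open Scope ring_scope.

(** * The Euclidean sphere and dilations *)

Section EuclideanNorm.
Context {R : realType} {n : nat}.
Local Notation rV := 'rV[R]_n.+1.

Lemma enorm_ge0 (x : rV) : 0 <= enorm x.
Proof. exact: sqrtr_ge0. Qed.

Lemma enormZ t (x : rV) : enorm (t *: x) = `|t| * enorm x.
Proof.
rewrite /enorm -(sqrtr_sqr t) -sqrtrM ?sqr_ge0// mulr_sumr.
by congr Num.sqrt; apply: eq_bigr => i _; rewrite mxE exprMn.
Qed.

Lemma ler_coord_enorm (x : rV) i : `|x 0 i| <= enorm x.
Proof.
rewrite /enorm -sqrtr_sqr ler_wsqrtr// (bigD1 i)//= lerDl sumr_ge0// => j _.
exact: sqr_ge0.
Qed.

Lemma enorm_eq0 (x : rV) : (enorm x == 0) = (x == 0).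
Proof.
apply/eqP/eqP => [x0|->].
  apply/rowP => i; apply/eqP; rewrite mxE -normr_le0 -x0.
  exact: ler_coord_enorm.
by rewrite /enorm big1 ?sqrtr0// => i _; rewrite mxE expr0n.
Qed.

Lemma enorm_gt0 (x : rV) : (0 < enorm x) = (x != 0).
Proof. by rewrite lt0r enorm_ge0 andbT enorm_eq0. Qed.

Lemma enorm_continuous : continuous (@enorm R n.+1).
Proof.
have sq : continuous (fun x : rV => \sum_(i < n.+1) x ord0 i ^+ 2).
  apply: (@continuous_big R _ +%R 0 _ _ rV) => [|i _ x].
    exact: (@add_continuous R^o).
  apply: (@continuous_comp rV R R (fun y : rV => y ord0 i) (@GRing.exp R ^~ 2)).
    exact: coord_continuous.
  exact: exprn_continuous.
move=> x; apply: (@continuous_comp rV R R _ (@Num.sqrt R)); first exact: sq.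
exact: sqrt_continuous.
Qed.

Lemma sphere_normalize (x : rV) : x != 0 -> sphere ((enorm x)^-1 *: x).
Proof.
move=> x0; rewrite /sphere/= enormZ gtr0_norm ?invr_gt0 ?enorm_gt0// mulVf//.
by rewrite enorm_eq0.
Qed.

Lemma sphere_neq0 (u : rV) : sphere u -> u != 0.
Proof. by rewrite -enorm_gt0 => ->. Qed.

Lemma enormZ_sphere t (u : rV) : sphere u -> 0 <= t -> enorm (t *: u) = t.
Proof. by move=> u1 t0; rewrite enormZ u1 mulr1 ger0_norm. Qed.

Lemma normalizeZ_sphere t (u : rV) : sphere u -> 0 < t ->
  (enorm (t *: u))^-1 *: (t *: u) = u.
Proof.
by move=> u1 t0; rewrite enormZ_sphere ?ltW// scalerA mulVf ?gt_eqF// scale1r.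
Qed.

Lemma enorm_normalize (x : rV) : enorm x *: ((enorm x)^-1 *: x) = x.
Proof.
have [->|x0] := eqVneq x 0; first by rewrite !scaler0.
by rewrite scalerA divff ?scale1r// enorm_eq0.
Qed.

Lemma sphere_nonempty : @sphere R n.+1 !=set0.
Proof.
exists ((enorm (const_mx 1 : rV))^-1 *: const_mx 1); apply: sphere_normalize.
by apply/eqP => /rowP/(_ 0); rewrite !mxE; apply/eqP; exact: oner_neq0.
Qed.

Lemma sphere_closed : closed (@sphere R n.+1).
Proof.
apply: (@closed_comp _ _ (@enorm R n.+1) [set 1]) => [x _|].
  exact: enorm_continuous.
exact: closed_eq.
Qed.

Lemma sphere_compact : compact (@sphere R n.+1).
Proof.
apply: bounded_closed_compact; last exact: sphere_closed.
exists 1; split => // M M1 x /= x1; rewrite (le_trans _ (ltW M1))//.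
change (`|x| <= 1%:nng%:num) => /=; rewrite [`|x|]mx_normrE.
apply/bigmax_leP; split => //= -[i j] _ /=; rewrite (ord1 i) -x1.
exact: ler_coord_enorm.
Qed.

Lemma sphere_measurable : measurable (sphere : set (@borel_rV R n.+1)).
Proof.
rewrite -[sphere]setCK; apply: measurableC; apply: sub_sigma_algebra => /=.
by rewrite openC; exact: sphere_closed.
Qed.

(** The preimage of an open interval is open in the subspace [D], hence the trace on [D] of an open
    set, and open intervals generate the Borel sets of the line. *)
Lemma within_continuous_measurable (D : set (@borel_rV R n.+1)) (f : rV -> R) :
  measurable D -> {within D, continuous f} ->
  measurable_fun D (f : @borel_rV R n.+1 -> R).
Proof.
move=> mD cf; apply: (measurability _ (RGenOpens.measurableE R)).
move=> _ [_ [a [b ->]] <-].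
have : open (f @^-1` `]a, b[ : set (subspace D)).
  by move/continuousP : cf; apply; exact: interval_open.
move=> /open_subspaceP[V oV VD]; rewrite setIC -VD.
by apply: measurableI => //; exact: sub_sigma_algebra.
Qed.

Lemma within_continuous_sphere_bounded (f : rV -> R) :
  {within sphere, continuous f} -> exists C, forall u, sphere u -> f u <= C.
Proof.
move=> /(compact_EVT_max sphere_nonempty sphere_compact)[c _ cf].
by exists (f c) => u su; apply: cf; rewrite inE.
Qed.

End EuclideanNorm.

Section Scaling.
Context {R : realType} {n : nat}.
Local Notation rV := 'rV[R]_n.+1.
Local Notation mu := (@lebesgue_rV R n.+1).
Local Open Scope ereal_scope.

(** For [c != 0] this is the image [c A]. The preimage form commutes by computation with
    intersections and complements. *)
Definition dilation (c : R) (A : set rV) : set rV := [set x | A (c^-1 *: x)].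

Lemma dilationK (c : R) A : c != 0%R -> dilation c^-1 (dilation c A) = A.
Proof.
move=> c0; apply/seteqP; split => x;
by rewrite /dilation/= scalerA invrK mulVf// scale1r.
Qed.

Lemma in_box_dilation (c : R) (b : rV * rV) : (0 < c)%R ->
  dilation c (in_box b) = in_box (c *: b.1, c *: b.2)%R.
Proof.
move=> c0; apply/seteqP; split => x xb i; have := xb i; rewrite /= !mxE.
  by rewrite ler_pdivlMl// ler_pdivrMl.
by rewrite ler_pdivlMl// ler_pdivrMl.
Qed.

Lemma box_volumeZ (c : R) (b : rV * rV) :
  box_volume (c *: b.1, c *: b.2)%R = (c ^+ n.+1 * box_volume b)%R.
Proof.
rewrite /box_volume; under eq_bigr do rewrite !mxE -mulrBr.
by rewrite big_split/= prodr_const card_ord.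
Qed.

(** Dilating a cover of [A] by boxes gives a cover of the dilated set, and each box volume is
    multiplied by [c ^+ n.+1]. *)
Let lebesgue_dilation_le (c : R) A : (0 < c)%R ->
  mu (dilation c A) <= (c ^+ n.+1)%:E * mu A.
Proof.
move=> c0; have cn0 : (0 < c ^+ n.+1)%R by rewrite exprn_gt0.
rewrite muleC -lee_pdivrMr//; apply: le_ereal_inf_tmp => _ [B [wB AB] <-].
rewrite lee_pdivrMr// muleC -nneseriesZl; last first.
  by move=> k _; rewrite lee_fin prodr_ge0// => i _; rewrite subr_ge0.
apply: ereal_inf_lbound.
exists (fun k => (c *: (B k).1, c *: (B k).2)%R).
  split => [k i|x /AB[k _ Bx]].
    by rewrite !mxE ler_pM2l.
  by exists k => //; rewrite -in_box_dilation.
by apply: eq_eseriesr => k _; rewrite box_volumeZ EFinM.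
Qed.

Lemma lebesgue_dilation (c : R) A : (0 < c)%R ->
  mu (dilation c A) = (c ^+ n.+1)%:E * mu A.
Proof.
move=> c0; have cn0 : (0 < c ^+ n.+1)%R by rewrite exprn_gt0.
apply/eqP; rewrite eq_le lebesgue_dilation_le//= -lee_pdivlMl//.
(* The reverse inequality is the first one for [c^-1] and the set [dilation c A]. *)
rewrite -{1}(@dilationK c A) ?gt_eqF// -exprVn lebesgue_dilation_le//.
by rewrite invr_gt0.
Qed.

(** Every test set is the dilation of some [Y], and the splitting of [Y] by [A] is multiplied by the
    common factor [c ^+ n.+1]. *)
Lemma caratheodory_dilation (c : R) A : (0 < c)%R ->
  mu.-caratheodory A -> mu.-caratheodory (dilation c A).
Proof.
move=> c0 cA X; have cn0 : (0 < c ^+ n.+1)%R by rewrite exprn_gt0.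
have XE : X = dilation c (dilation c^-1 X).
  by rewrite -{1}(invrK c) dilationK// invr_neq0// gt_eqF.
move: (dilation c^-1 X) XE => Y ->.
rewrite (_ : _ `&` _ = dilation c (Y `&` A))//.
rewrite (_ : _ `&` ~` _ = dilation c (Y `&` ~` A))//.
rewrite !lebesgue_dilation//.
have -> : mu Y = mu (Y `&` A) + mu (Y `&` ~` A) by exact: cA.
by rewrite ge0_muleDr//; exact: outer_measure_ge0.
Qed.

Lemma lebesgue_set1 (x : rV) : mu [set x] = 0.
Proof.
apply/eqP; rewrite eq_le outer_measure_ge0 andbT; apply: ereal_inf_lbound.
exists (fun=> (x, x)) => /=.
  by split=> // y ->; exists 0%N => // i; rewrite lexx.
rewrite eseries0// => k _ _; congr (_%:E).
by rewrite /box_volume (bigD1 ord0)//= subrr mul0r.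
Qed.

Lemma sphere_measure_lty : sphere_measure (@sphere R n.+1) < +oo.
Proof.
have : mu (cone sphere) < +oo.
  apply: (@le_lt_trans _ _ (2 ^+ n.+1)%:E); last exact: ltry.
  apply: ereal_inf_lbound.
  (* The cone lies in the cube of vertices -1 and 1, of volume [2 ^+ n.+1]; the sequence is
     completed by degenerate boxes at the origin. *)
  exists (fun k : nat =>
    if k is 0%N then (const_mx (-1), const_mx 1)%R else (0, 0)%R).
    split => [[|k] i|x [t [u [/andP[t0 t1] su _ ->]]]] /=; rewrite ?mxE//.
    exists 0%N => // i /=; rewrite !mxE -ler_norml.
    rewrite normrM mulr_ile1//; first by rewrite ger0_norm// ltW.
    by rewrite -su ler_coord_enorm.
  rewrite (@nneseriesD1 _ _ 0%N)//=; last first.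
    by move=> [|k] _; rewrite lee_fin prodr_ge0// => i _;
      rewrite !mxE ?subr0// opprK addr_ge0.
  rewrite eseries0 ?adde0.
    rewrite /box_volume/=; under eq_bigr do rewrite !mxE opprK.
    by rewrite prodr_const card_ord.
  move=> [|k] _ //= _.
  by rewrite /box_volume/= (bigD1 ord0)//= !mxE subrr mul0r.
by move=> coney; rewrite /sphere_measure lte_mul_pinfty ?lee_fin.
Qed.

End Scaling.

(** * Volume in polar coordinates *)

Section StarBodyVolume.
Context {R : realType} {n : nat}.
Local Notation rV := 'rV[R]_n.+1.
Local Notation mu := (@lebesgue_rV R n.+1).

(** The origin is a separate case: there [(enorm x)^-1 *: x] is zero, which is not a direction. *)
Lemma star_bodyE (M : set rV) (x : rV) : star_body M ->
  M x <-> x = 0 \/ enorm x <= radial M ((enorm x)^-1 *: x).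
Proof.
case=> segM rho0 rhoM _.
have M0 : M 0.
  have [u su] := @sphere_nonempty R n.
  rewrite -(scale0r (radial M u *: u)).
  by apply: segM; [exact: (rhoM u su).1|rewrite lexx ler01].
have [->|x0] := eqVneq x 0; first by split => // _; left.
have su := sphere_normalize x0; have [Mu maxu] := rhoM _ su.
split=> [Mx|[/eqP|le_x]]; first by right; apply: maxu; rewrite enorm_normalize.
  by rewrite (negbTE x0).
have := segM _ (enorm x / radial M ((enorm x)^-1 *: x)) Mu.
rewrite scalerA divfK ?gt_eqF ?rho0// enorm_normalize; apply.
by rewrite divr_ge0 ?enorm_ge0 ?(ltW (rho0 _ su))//= ler_pdivrMr ?rho0// mul1r.
Qed.

Lemma star_bodyZ_sphere (M : set rV) t (u : rV) : star_body M -> sphere u ->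
  0 < t -> M (t *: u) <-> t <= radial M u.
Proof.
move=> sM su t0; apply: (iff_trans (star_bodyE _ sM)).
rewrite normalizeZ_sphere// (enormZ_sphere su (ltW t0)).
split=> [[/eqP|//]|]; last by right.
by rewrite scaler_eq0 gt_eqF//= (negbTE (sphere_neq0 su)).
Qed.

Lemma radial_bounds (M : set rV) : star_body M ->
  exists m B, 0 < m /\ forall u, sphere u -> m <= radial M u <= B.
Proof.
move=> [_ rho0 _ crho].
have [c cs cmin] := compact_EVT_min sphere_nonempty sphere_compact crho.
have [B Bmax] := within_continuous_sphere_bounded crho.
exists (radial M c), B; split; first by apply: rho0; rewrite inE in cs.
by move=> u su; rewrite cmin ?inE// Bmax.
Qed.

Lemma radial_measurable (M : set rV) : star_body M ->
  measurable_fun (sphere : set (@borel_rV R n.+1)) (radial M).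
Proof.
move=> [_ _ _ ?]; apply: within_continuous_measurable => //.
exact: sphere_measurable.
Qed.

Local Open Scope ereal_scope.

(** * Volume and polar integral compared on geometric shells *)

Section Shells.
Variables (M : set rV) (m q : R).
Hypotheses (starM : star_body M) (m0 : (0 < m)%R) (q1 : (1 < q)%R).
Hypothesis mrho : forall u, sphere u -> (m <= radial M u)%R.

Let q0 : (0 < q)%R. Proof. exact: lt_trans q1. Qed.

Let c (k : nat) : R := (m * q ^+ k)%R.

Let c_gt0 k : (0 < c k)%R. Proof. by rewrite mulr_gt0// exprn_gt0. Qed.

Let cS k : c k.+1 = (q * c k)%R. Proof. by rewrite /c exprS mulrCA. Qed.

Let A (k : nat) : set (@borel_rV R n.+1) :=
  [set u | sphere u /\ (c k <= radial M u < c k.+1)%R].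

Let A_measurable k : measurable (A k).
Proof.
rewrite (_ : A k = sphere `&` radial M @^-1` `[c k, c k.+1[%classic).
  by apply: radial_measurable => //; exact: sphere_measurable.
by apply/seteqP; split => u /=; rewrite in_itv.
Qed.

Let A_disjoint j k u : A j u -> A k u -> j = k.
Proof.
wlog jk : j k / (j < k)%N.
  move=> wl Aj Ak; have [jk|kj|//] := ltngtP j k; first exact: wl.
  by apply/esym; exact: wl.
move=> [_ /andP[_ uj]] [_ /andP[uk _]]; move: uj.
rewrite ltNge (le_trans _ uk)// ler_wpM2l ?(ltW m0)//.
by rewrite ler_weXn2l// ltW.
Qed.

Let A_cover : sphere = \bigcup_k A k.
Proof.
apply/seteqP; split=> [u su|u [k _ []]//].
have rho0 : (0 < radial M u)%R by exact: lt_le_trans (mrho su).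
have : exists k, (radial M u < c k.+1)%R.
  have : (q^-1 ^+ k @[k --> \oo] --> (0 : R))%R.
    apply: cvg_expr; rewrite gtr0_norm ?invr_gt0//.
    by rewrite invf_lt1.
  move=> /cvgr_lt/(_ (m / radial M u)%R).
  rewrite divr_gt0// => /(_ isT)[N _ NP].
  exists N; have := NP N.+1 (leqnSn N).
  rewrite /= exprVn ltr_pdivlMr// mulrC ltr_pdivrMr ?exprn_gt0//.
(* For the least [k] with [radial M u < c k.+1], the lower bound [c k] comes from minimality, or
   from [c 0 = m] when [k] is 0. *)
move=> /ex_minnP[k uk mink]; exists k => //; split => //; rewrite uk andbT.
case: k uk mink => [|k] uk mink; first by rewrite /c expr0 mulr1 mrho.
by rewrite leNgt; apply/negP => /mink; rewrite ltnn.
Qed.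

Let coneA k : mu.-caratheodory (cone (A k)).
Proof. by apply: borel_caratheodory; exact: cone_measurable. Qed.

(** Lower sum: the volumes of the cones over the pieces, cut at the inner radii [c k]. Cutting at
    the outer radii [c k.+1] multiplies it by [q ^+ n.+1]. *)
Let S := \sum_(0 <= k <oo) (c k ^+ n.+1)%:E * mu (cone (A k)).

Let term_ge0 k : 0 <= (c k ^+ n.+1)%:E * mu (cone (A k)).
Proof. by rewrite mule_ge0 ?outer_measure_ge0// lee_fin exprn_ge0// ltW. Qed.

Let SS : \sum_(0 <= k <oo) (c k.+1 ^+ n.+1)%:E * mu (cone (A k)) =
  (q ^+ n.+1)%:E * S.
Proof.
rewrite -nneseriesZl//; apply: eq_eseriesr => k _.
by rewrite cS exprMn EFinM muleA.
Qed.

(** The cones cut at the inner radii lie in [M]. They are disjoint, a nonzero point having only one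
    direction, so countable additivity applies to their union. *)
Let lebesgue_ge : S <= mu M.
Proof.
pose D k := dilation (c k) (cone (A k)).
have DE k x : D k x -> exists t u, [/\ (0 < t <= c k)%R, A k u & x = t *: u].
  move=> [t [u [/andP[t0 t1] su Au xE]]]; exists (c k * t)%R, u.
  rewrite mulr_gt0//= ger_pMr// t1; split => //.
  by rewrite -scalerA -xE scalerA divff ?scale1r// gt_eqF.
have tD : trivIset setT D.
  apply/trivIsetP => i j _ _ ij; rewrite -subset0 => x.
  move=> [/DE[s [u [/andP[s0 _] Au ->]]] /DE[t [v [/andP[t0 _] Av uv]]]].
  move/eqP : ij; apply; apply: (A_disjoint Au).
  by rewrite -(normalizeZ_sphere Au.1 s0) uv normalizeZ_sphere//; exact: Av.1.
have cD k : mu.-caratheodory (D k) by exact: caratheodory_dilation.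
have DM : \bigcup_k D k `<=` M.
  move=> x [k _ /DE[t [u [/andP[t0 tc] [su /andP[cu _]] ->]]]].
  by apply/star_bodyZ_sphere => //; exact: le_trans cu.
rewrite (le_trans _ (le_outer_measure mu _ _ DM))//.
have := @caratheodory_measure_sigma_additive _ _ mu D cD tD
  (caratheodory_measurable_bigcup cD).
move=> /cvg_lim <-//; rewrite le_eqVlt; apply/orP; left; apply/eqP.
by apply: eq_eseriesr => k _; apply/esym; exact: lebesgue_dilation.
Qed.

(** The cones cut at the outer radii cover [M] apart from the origin; countable subadditivity
    concludes. *)
Let lebesgue_le : mu M <= (q ^+ n.+1)%:E * S.
Proof.
pose D k := dilation (c k.+1) (cone (A k)).
(* Cones omit their apex, so the origin is added as a null set. *)
have MD : M `<=` [set 0%R] `|` \bigcup_k D k.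
  move=> x Mx; have [->|x0] := eqVneq x 0%R; first by left.
  right; have su := sphere_normalize x0.
  have := su; rewrite A_cover => -[k _ Ak]; exists k => //.
  exists ((c k.+1)^-1 * enorm x)%R, ((enorm x)^-1 *: x)%R; split => //.
    rewrite mulr_gt0 ?invr_gt0 ?enorm_gt0//= ler_pdivrMl// mulr1.
    have [_ /andP[_ /ltW]] := Ak; apply: le_trans.
    by have /(star_bodyE x starM)[/eqP|//] := Mx; rewrite (negbTE x0).
  by rewrite -scalerA enorm_normalize.
apply: le_trans (le_outer_measure mu _ _ MD) _.
apply: le_trans (outer_measureU2 _ _ _) _.
rewrite [X in X + _]lebesgue_set1 add0e -SS.
apply: le_trans (outer_measure_sigma_subadditive _ _) _.
apply: lee_nneseries => [k _ _|k _]; first exact: outer_measure_ge0.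
by rewrite -lebesgue_dilation.
Qed.

Let I := \int[sphere_measure]_(u in sphere) (radial M u ^+ n.+1)%:E.

Let integrand_measurable (D : set (@borel_rV R n.+1)) : D `<=` sphere ->
  measurable_fun D (fun u : @borel_rV R n.+1 => (radial M u ^+ n.+1)%:E).
Proof.
move=> Ds; apply/measurable_EFinP; apply: measurable_funX.
apply: measurable_funS Ds _; first exact: sphere_measurable.
exact: radial_measurable.
Qed.

Let IE : I = \sum_(0 <= k <oo)
  \int[sphere_measure]_(u in A k) (radial M u ^+ n.+1)%:E.
Proof.
rewrite /I A_cover ge0_integral_bigcup//.
- by rewrite -A_cover; exact: integrand_measurable.
- rewrite -A_cover => u su; rewrite lee_fin exprn_ge0//.
  exact: le_trans (ltW m0) (mrho su).
- apply/trivIsetP => i j _ _ /eqP ij; rewrite -subset0 => u [Ai Aj].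
  exact: ij (A_disjoint Ai Aj).
Qed.

Let sphere_measure_shell k (r : R) :
  r%:E * sphere_measure (A k) = n.+1%:R%:E * (r%:E * mu (cone (A k))).
Proof. by rewrite /sphere_measure muleCA. Qed.

(** On [A k] the integrand is at least the constant [c k ^+ n.+1], whose integral is [n.+1] times
    the term of index [k] of [S]. *)
Let integral_ge : n.+1%:R%:E * S <= I.
Proof.
rewrite IE -nneseriesZl//; apply: lee_nneseries => [k _ _|k _].
  by rewrite mule_ge0.
rewrite -sphere_measure_shell -integral_cst//; apply: ge0_le_integral => //.
- by move=> u _; rewrite lee_fin exprn_ge0// ltW.
- by apply: integrand_measurable => u [].
- move=> u [_ /andP[cu _]]; rewrite lee_fin lerXn2r// nnegrE ltW//.
  exact: lt_le_trans cu.
Qed.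

Let integral_le : I <= (q ^+ n.+1)%:E * (n.+1%:R%:E * S).
Proof.
rewrite muleCA -SS IE -nneseriesZl => [|k _]; last first.
  by rewrite mule_ge0 ?outer_measure_ge0// lee_fin exprn_ge0// ltW.
apply: lee_nneseries => [k _ _|k _].
  by apply: integral_ge0 => u [su _]; rewrite lee_fin exprn_ge0//;
    exact: le_trans (ltW m0) (mrho su).
rewrite -sphere_measure_shell -integral_cst//; apply: ge0_le_integral => //.
- by move=> u [su _]; rewrite lee_fin exprn_ge0//;
    exact: le_trans (ltW m0) (mrho su).
- by apply: integrand_measurable => u [].
- move=> u [su /andP[_ /ltW cu]]; rewrite lee_fin lerXn2r// nnegrE.
    exact: le_trans (ltW m0) (mrho su).
  exact: ltW.
Qed.

(** Both quantities lie between [n.+1 * S] and [q ^+ n.+1] times it. *)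
Lemma lebesgue_integral_shells :
  n.+1%:R%:E * mu M <= (q ^+ n.+1)%:E * I /\
  I <= (q ^+ n.+1)%:E * (n.+1%:R%:E * mu M).
Proof.
have qn0 : 0 <= (q ^+ n.+1)%:E by rewrite lee_fin exprn_ge0// ltW.
split.
  rewrite (le_trans (lee_wpmul2l _ lebesgue_le))// muleCA.
  by apply: lee_wpmul2l => //; exact: integral_ge.
by rewrite (le_trans integral_le)// lee_wpmul2l// lee_wpmul2l.
Qed.

End Shells.

(** The limit [q -> 1] in the extended reals, where [y] may be infinite: it is enough to bound
    [r * x] for [0 < r < 1], and some [q > 1] satisfies [q ^+ n.+1 < r^-1]. *)
Lemma lee_exprn_mul_gt1 (x y : \bar R) : 0 <= x ->
  (forall q, (1 < q)%R -> x <= (q ^+ n.+1)%:E * y) -> x <= y.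
Proof.
move=> x0 xy; apply/lee_mul01Pr => // r /andP[r0 r1].
have q1 : (q ^+ n.+1 @[q --> (1 : R)^'+] --> (1 : R))%R.
  apply: cvg_at_right_filter; rewrite -{2}(expr1n R n.+1).
  exact: exprn_continuous.
near ((1 : R)%R^'+) => q.
have q_gt1 : (1 < q)%R by near: q; exact: nbhs_right_gt.
have qr : (q ^+ n.+1 < r^-1)%R.
  by near: q; apply: (cvgr_lt _ q1); rewrite invf_gt1.
have y0 : 0 <= y.
  rewrite -(@pmule_rge0 _ (q ^+ n.+1)%:E) ?(le_trans x0)//; first exact: xy.
  by rewrite lte_fin exprn_gt0// (lt_trans _ q_gt1).
rewrite muleC -lee_pdivlMr// (le_trans (xy q q_gt1))// muleC.
by rewrite lee_wpmul2l// lee_fin ltW.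
Unshelve. all: by end_near. Qed.

Lemma lebesgue_star_body (M : set rV) : star_body M ->
  n.+1%:R%:E * mu M =
  \int[sphere_measure]_(u in sphere) (radial M u ^+ n.+1)%:E.
Proof.
move=> sM; have [m [B [m0 mB]]] := radial_bounds sM.
have mrho u : sphere u -> (m <= radial M u)%R by move=> /mB/andP[].
apply/eqP; rewrite eq_le; apply/andP; split; apply: lee_exprn_mul_gt1.
- by rewrite mule_ge0// outer_measure_ge0.
- by move=> q q1; exact: (lebesgue_integral_shells sM m0 q1 mrho).1.
- apply: integral_ge0 => u su; rewrite lee_fin exprn_ge0//.
  exact: le_trans (ltW m0) (mrho _ su).
- by move=> q q1; exact: (lebesgue_integral_shells sM m0 q1 mrho).2.
Qed.

Lemma bounded_sphere_integrable (f : rV -> R) (C : R) :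
  measurable_fun (sphere : set (@borel_rV R n.+1)) f ->
  (forall u, sphere u -> `|f u| <= C)%R ->
  sphere_measure.-integrable sphere (EFin \o f).
Proof.
move=> mf fC; apply/integrableP; split; first exact/measurable_EFinP.
have mS := @sphere_measurable R n.
apply: (@le_lt_trans _ _ (\int[sphere_measure]_(u in sphere) (cst C%:E u))).
  apply: ge0_le_integral => //.
  by apply: measurableT_comp => //; exact/measurable_EFinP.
rewrite integral_cst// lte_mul_pinfty//; last exact: sphere_measure_lty.
have [u su] := @sphere_nonempty R n.
by rewrite lee_fin (le_trans _ (fC u su)).
Qed.

Lemma radialX_integrable (M : set rV) : star_body M ->
  sphere_measure.-integrable sphere
    (EFin \o (fun u : @borel_rV R n.+1 => radial M u ^+ n.+1))%R.
Proof.
move=> sM; have [m [B [m0 mB]]] := radial_bounds sM.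
apply: (@bounded_sphere_integrable _ (B ^+ n.+1)).
  by apply: measurable_funX; exact: radial_measurable.
move=> u /mB/andP[mu_ uB]; rewrite normrX lerXn2r ?nnegrE//.
  by rewrite (le_trans (ltW m0))// (le_trans mu_).
by rewrite ger0_norm// (le_trans (ltW m0)).
Qed.

Lemma volume_star_body (M : set rV) : star_body M ->
  (volume M = n.+1%:R^-1 *
    \int[sphere_measure]_(u in sphere) (radial M u ^+ n.+1))%R.
Proof.
move=> sM; rewrite /Rintegral -lebesgue_star_body//.
(* [volume] is a [fine], so [mu M] has to be finite; the positive factor [n.+1] would carry an
   infinite value over to the product. *)
have : n.+1%:R%:E * mu M \is a fin_num.
  rewrite lebesgue_star_body//.
  exact: (integrable_fin_num sphere_measurable (radialX_integrable sM)).
rewrite /volume; case: (mu M) => [r||] /=.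
- by rewrite mulKf// pnatr_eq0.
- by rewrite gt0_muley// lte_fin ltr0n.
- by rewrite gt0_muleNy// lte_fin ltr0n.
Qed.

End StarBodyVolume.

(** * Existence of Orlicz sums *)

Section RadialFunction.
Context {R : realType} {n : nat}.
Local Notation rV := 'rV[R]_n.+1.
Variable r : rV -> R.
Hypothesis r_gt0 : forall u, sphere u -> 0 < r u.

(** The form that [star_bodyE] gives to a star body with radial function [r]. *)
Definition star_of : set rV :=
  [set x | x = 0 \/ enorm x <= r ((enorm x)^-1 *: x)].

Lemma star_of_sphere u t : sphere u -> 0 < t -> star_of (t *: u) <-> t <= r u.
Proof.
move=> su t0; rewrite /star_of/=.
rewrite normalizeZ_sphere// (enormZ_sphere su (ltW t0)).
split=> [[/eqP|//]|]; last by right.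
by rewrite scaler_eq0 gt_eqF//= (negbTE (sphere_neq0 su)).
Qed.

Let star_of_le u t : sphere u -> star_of (t *: u) -> t <= r u.
Proof.
move=> su; have [t0 _|t0] := leP t 0; last by move=> /star_of_sphere; exact.
exact: le_trans t0 (ltW (r_gt0 su)).
Qed.

Let star_of_r u : sphere u -> star_of (r u *: u).
Proof. by move=> su; apply/star_of_sphere => //; exact: r_gt0. Qed.

Lemma radial_star_of u : sphere u -> radial star_of u = r u.
Proof.
move=> su; apply/eqP; rewrite eq_le; apply/andP; split.
  apply: ge_sup => [|t]; last exact: star_of_le.
  by exists (r u); exact: star_of_r.
apply: ub_le_sup; last exact: star_of_r.
by exists (r u) => t; exact: star_of_le.
Qed.

Lemma star_of_star_body : {within sphere, continuous r} -> star_body star_of.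
Proof.
move=> cr; split.
- move=> x t xr /andP[]; rewrite le_eqVlt => /predU1P[<- _|t0 t1].
    by left; rewrite scale0r.
  have [->|x0] := eqVneq x 0; first by left; rewrite scaler0.
  have su := sphere_normalize x0; have ex0 : 0 < enorm x by rewrite enorm_gt0.
  move: xr; rewrite -(enorm_normalize x) => /(star_of_le su) xr.
  rewrite scalerA; apply/star_of_sphere => //.
    by rewrite mulr_gt0.
  by rewrite (le_trans _ xr)// ger_pMl.
- by move=> u su; rewrite radial_star_of// r_gt0.
- by move=> u su; rewrite radial_star_of//; split; [exact: star_of_r|
    move=> t; exact: star_of_le].
- apply: (@subspace_eq_continuous _ _ _ r) => // u; rewrite inE => su.
  exact/esym/radial_star_of.
Qed.

End RadialFunction.

(** The set [star_of r] meets the defining condition, which rules out the default of [xget]; the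
    chosen set therefore meets it as well. *)
Lemma orlicz_sum_spec (R : realType) (n : nat) (eps : R) (phi1 phi2 : R -> R)
    (K L : set 'rV[R]_n.+1) (r : 'rV[R]_n.+1 -> R) :
  (forall u, sphere u -> 0 < r u) -> {within sphere, continuous r} ->
  (forall u, sphere u ->
     1 = phi1 (r u / radial K u) + eps * phi2 (r u / radial L u)) ->
  star_body (orlicz_sum eps phi1 phi2 K L) /\
  forall u, sphere u ->
    1 = phi1 (radial (orlicz_sum eps phi1 phi2 K L) u / radial K u) +
        eps * phi2 (radial (orlicz_sum eps phi1 phi2 K L) u / radial L u).
Proof.
move=> r0 cr rE; rewrite /orlicz_sum; case: xgetP => [M _ //|/(_ (star_of r))].
case; split; first exact: star_of_star_body.
by move=> u su; rewrite radial_star_of//; exact: rE.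
Qed.

(** * The scalar equation of the sum: solvability and continuous dependence *)

Section OrliczEquation.
Context {R : realType}.
Implicit Types p : R -> R.

Lemma Phi1_le p s t : Phi1 p -> 0 <= s -> s <= t -> p s <= p t.
Proof.
move=> [_ _ pinc _ _] s0; rewrite le_eqVlt => /predU1P[->//|st].
by rewrite ltW// pinc.
Qed.

Lemma Phi1_gt0 p t : Phi1 p -> 0 < t -> 0 < p t.
Proof. by move=> [_ _ pinc p0 _] t0; rewrite -p0 pinc. Qed.

(** Values of [p] at negative arguments are arbitrary; composing with [Num.max 0] gives a function
    continuous on the whole line. *)
Lemma Phi1_continuous_max p : Phi1 p ->
  continuous (fun t : R => p (Num.max 0 t)).
Proof.
move=> [_ /subspace_continuousP cp _ _ _] t.
have t0 : 0 <= Num.max 0 t by rewrite le_max lexx.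
have ct : Num.max 0 s @[s --> t] --> Num.max 0 t.
  by apply: continuous_max => //; exact: cvg_cst.
apply: cvg_trans (cp (Num.max 0 t) _); last by rewrite /= in_itv/= t0.
move=> U /= /ct; rewrite /= !nbhs_simpl /= => Ut.
near=> s; have /(_ s) := near Ut; apply => //.
by rewrite /= in_itv/= andbT le_max lexx.
Unshelve. all: by end_near. Qed.

Lemma Phi1_continuous p t : Phi1 p -> 0 < t -> {for t, continuous p}.
Proof.
move=> Pp t0; have := @Phi1_continuous_max p Pp t.
rewrite /continuous_at (max_idPr (ltW t0)); apply: cvg_trans.
apply: near_eq_cvg; near=> s; rewrite (max_idPr _)// ltW//.
by near: s; exact: lt_nbhsr.
Unshelve. all: by end_near. Qed.

Variables (p1 p2 : R -> R) (eps : R).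
Hypotheses (Pp1 : Phi1 p1) (Pp2 : Phi1 p2) (eps0 : 0 < eps).

(** Intermediate values between 0, where the right-hand side vanishes, and [a^-1], where its first
    term is already [p1 1 = 1]. *)
Lemma orlicz_equation_solvable a b : 0 < a -> 0 < b ->
  exists s, 0 < s /\ 1 = p1 (s * a) + eps * p2 (s * b).
Proof.
move=> a0 b0; have [_ _ _ p10 p11] := Pp1; have [p2ge0 _ _ p20 _] := Pp2.
pose G s := p1 (Num.max 0 (s * a)) + eps * p2 (Num.max 0 (s * b)).
have cG : continuous G.
  move=> s; apply: cvgD.
    apply: (@continuous_comp R R R (fun t => t * a)
      (fun t => p1 (Num.max 0 t)));
      last exact: Phi1_continuous_max.
    by apply: cvgMl; exact: cvg_id.
  apply: cvgMr; apply: (@continuous_comp R R R (fun t => t * b)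
      (fun t => p2 (Num.max 0 t)));
      last exact: Phi1_continuous_max.
  by apply: cvgMl; exact: cvg_id.
have G0 : G 0 = 0 by rewrite /G !mul0r maxxx p10 p20 mulr0 addr0.
have G1 : 1 <= G a^-1.
  rewrite /G mulVf ?gt_eqF// (max_idPr ler01) p11 lerDl.
  by rewrite mulr_ge0 ?(ltW eps0)// p2ge0// le_max lexx.
have [||s] := @IVT _ G 0 a^-1 1 _ (continuous_subspaceT cG).
- by rewrite invr_ge0 ltW.
- by rewrite G0 ge_min ler01 le_max G1 orbT.
rewrite in_itv/= => /andP[]; rewrite le_eqVlt => /predU1P[<- _|s0 _].
  by rewrite G0 => /esym/eqP; rewrite oner_eq0.
move=> Gs; exists s; split => //.
by rewrite -Gs /G !(max_idPr _)// ltW// mulr_gt0.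
Qed.

Let equation_lt a b s t : 0 < a -> 0 < b -> 0 <= s -> s < t ->
  p1 (s * a) + eps * p2 (s * b) < p1 (t * a) + eps * p2 (t * b).
Proof.
move=> a0 b0 s0 st; have [_ _ inc1 _ _] := Pp1; have [_ _ inc2 _ _] := Pp2.
by rewrite ltrD// ?ltr_pM2l// (inc1, inc2) ?ltr_pM2r// mulr_ge0// ltW.
Qed.

Let equation_le a b s t : 0 < a -> 0 < b -> 0 <= s -> s <= t ->
  p1 (s * a) + eps * p2 (s * b) <= p1 (t * a) + eps * p2 (t * b).
Proof.
move=> a0 b0 s0; rewrite le_eqVlt => /predU1P[->//|st].
exact/ltW/equation_lt.
Qed.

(** The right-hand side is strictly increasing in the unknown: at [u] it is below 1 at some
    [lo < s u] and above 1 at [s u + e]. Both inequalities persist for [v] near [u] and trap [s v]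
    between these two barriers. *)
Lemma orlicz_equation_continuous (T : topologicalType) (D : set T)
    (a b s : T -> R) :
  {within D, continuous a} -> {within D, continuous b} ->
  (forall u, D u -> 0 < a u) -> (forall u, D u -> 0 < b u) ->
  (forall u, D u -> 0 < s u) ->
  (forall u, D u -> 1 = p1 (s u * a u) + eps * p2 (s u * b u)) ->
  {within D, continuous s}.
Proof.
move=> /subspace_continuousP ca /subspace_continuousP cb a0 b0 s0 sE.
apply/subspace_continuousP => u Du.
have cH t : 0 < t ->
    p1 (t * a v) + eps * p2 (t * b v) @[v --> within D (nbhs u)]
    --> p1 (t * a u) + eps * p2 (t * b u).
  move=> t0; apply: cvgD; last apply: cvgMr.
    apply: (@continuous_cvg _ _ _ _ _ (fun v => t * a v) p1);
      last by apply: cvgMr; exact: ca.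
    by apply: Phi1_continuous => //; rewrite mulr_gt0// a0.
  apply: (@continuous_cvg _ _ _ _ _ (fun v => t * b v) p2);
    last by apply: cvgMr; exact: cb.
  by apply: Phi1_continuous => //; rewrite mulr_gt0// b0.
apply/cvgrPdist_lt => e e0.
(* Half of the minimum keeps [lo] both positive and above [s u - e]. *)
pose lo := s u - Num.min e (s u) / 2.
have m0 : 0 < Num.min e (s u) by rewrite lt_min e0 s0.
have lo0 : 0 < lo.
  rewrite subr_gt0 ltr_pdivrMr// (@le_lt_trans _ _ (s u))//.
    by rewrite ge_min lexx orbT.
  by rewrite ltr_pMr ?s0// ltr1n.
have lo_s : lo < s u by rewrite ltrBlDr ltrDl divr_gt0.
have e_lo : s u - e < lo.
  rewrite ltrD2l ltrN2 ltr_pdivrMr// (@le_lt_trans _ _ e)//.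
    by rewrite ge_min lexx.
  by rewrite ltr_pMr// ltr1n.
have lo1 : p1 (lo * a u) + eps * p2 (lo * b u) < 1.
  by rewrite [ltRHS](sE u Du) equation_lt ?a0 ?b0// ltW.
have hi1 : 1 < p1 ((s u + e) * a u) + eps * p2 ((s u + e) * b u).
  by rewrite [ltLHS](sE u Du) equation_lt ?a0 ?b0 ?(ltW (s0 _ Du))// ltrDl.
have se0 : 0 < s u + e by rewrite addr_gt0// s0.
near=> v.
have Dv : D v by near: v; exact: withinT.
rewrite ltr_distlC; apply/andP; split.
  apply: (lt_le_trans e_lo); rewrite leNgt; apply/negP => /ltW v_lo.
  have : p1 (lo * a v) + eps * p2 (lo * b v) < 1.
    by near: v; exact: (cvgr_lt _ (cH _ lo0)).
  rewrite ltNge => /negP; apply; rewrite [leLHS](sE v Dv).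
  by apply: equation_le => //; rewrite ?a0 ?b0// ltW// s0.
rewrite ltNge; apply/negP => hi_v.
have : 1 < p1 ((s u + e) * a v) + eps * p2 ((s u + e) * b v).
  by near: v; exact: (cvgr_gt _ (cH _ se0)).
rewrite ltNge => /negP; apply; rewrite [leRHS](sE v Dv).
by apply: equation_le => //; rewrite ?a0 ?b0// ltW.
Unshelve. all: by end_near. Qed.

Lemma orlicz_equation_radial (T : topologicalType) (D : set T) (a b : T -> R) :
  {within D, continuous a} -> {within D, continuous b} ->
  (forall u, D u -> 0 < a u) -> (forall u, D u -> 0 < b u) ->
  exists s : T -> R, [/\ {within D, continuous s},
    forall u, D u -> 0 < s u &
    forall u, D u -> 1 = p1 (s u * a u) + eps * p2 (s u * b u)].
Proof.
move=> ca cb a0 b0.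
(* The condition is vacuous outside [D], so that choice yields a total function. *)
pose P u t := D u -> 0 < t /\ 1 = p1 (t * a u) + eps * p2 (t * b u).
have [s sP] : {s : T -> R & forall u, P u (s u)}.
  apply: (@choice _ _ P) => u; have [Du|nDu] := pselect (D u).
    have [t tP] := orlicz_equation_solvable (a0 u Du) (b0 u Du).
    by exists t.
  by exists 0 => /nDu.
exists s; split => [|u /sP[]//|u /sP[]//].
apply: (orlicz_equation_continuous ca cb a0 b0) => u /sP[]//.
Qed.

End OrliczEquation.

Lemma within_continuousV (R : realType) (T : topologicalType) (D : set T)
    (f : T -> R) : (forall u, D u -> f u != 0) ->
  {within D, continuous f} -> {within D, continuous (fun u => (f u)^-1)}.
Proof.
move=> f0 /subspace_continuousP cf; apply/subspace_continuousP => u Du.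
by apply: cvgV; [exact: f0|exact: cf].
Qed.

Section OrliczSum.
Context {R : realType} {n : nat}.
Variables (K L : set 'rV[R]_n.+1) (phi1 phi2 : R -> R) (eps : R).
Hypotheses (starK : star_body K) (starL : star_body L) (eps0 : 0 < eps).

Let M := orlicz_sum eps phi1 phi2 K L.

Let orlicz_sum_prop := star_body M /\ forall u, sphere u ->
  1 = phi1 (radial M u / radial K u) + eps * phi2 (radial M u / radial L u).

Lemma orlicz_sum_Phi1 : Phi1 phi1 -> Phi1 phi2 -> orlicz_sum_prop.
Proof.
move=> P1 P2; have [_ K0 _ cK] := starK; have [_ L0 _ cL] := starL.
have [||||s [cs s0 sE]] := @orlicz_equation_radial _ _ _ _ P1 P2 eps0 _
    sphere (fun u => (radial K u)^-1) (fun u => (radial L u)^-1).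
- by apply: within_continuousV => // u su; rewrite gt_eqF ?K0.
- by apply: within_continuousV => // u su; rewrite gt_eqF ?L0.
- by move=> u su; rewrite invr_gt0 K0.
- by move=> u su; rewrite invr_gt0 L0.
exact: (@orlicz_sum_spec _ _ _ _ _ _ _ s).
Qed.

Lemma orlicz_sum_Psi1 : Psi1 phi1 -> Psi1 phi2 -> orlicz_sum_prop.
Proof.
move=> [_ [p1 P1 p1E]] [_ [p2 P2 p2E]].
have [_ K0 _ cK] := starK; have [_ L0 _ cL] := starL.
(* The coefficients are now the radial functions themselves, in place of their inverses. *)
have [s [cs s0 sE]] := orlicz_equation_radial P1 P2 eps0 cK cL K0 L0.
apply: (@orlicz_sum_spec _ _ _ _ _ _ _ (fun u => (s u)^-1)).
- by move=> u su; rewrite invr_gt0 s0.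
- by apply: within_continuousV => // u su; rewrite gt_eqF ?s0.
- move=> u su; rewrite [LHS](sE u su).
  by rewrite p1E ?p2E ?mulr_gt0 ?s0 ?K0 ?L0// !invfM.
Qed.

End OrliczSum.

(** * First variation of the volume *)

Section Variation.
Context {R : realType} {n : nat}.
Local Notation rV := 'rV[R]_n.+1.
Local Notation borel := (@borel_rV R n.+1).

(** Dominated convergence along every sequence of positive numbers tending to 0; the constant [C] is
    integrable because the sphere has finite measure. *)
Lemma cvg_Rintegral_sphere (h : R -> rV -> R) (h0 : rV -> R) (C : R) :
  (forall e, 0 < e -> measurable_fun (sphere : set borel) (h e)) ->
  measurable_fun (sphere : set borel) h0 ->
  (forall u, sphere u -> h e u @[e --> 0^'+] --> h0 u) ->
  (\forall e \near 0^'+, forall u, sphere u -> `|h e u| <= C) ->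
  \int[sphere_measure]_(u in sphere) h e u @[e --> 0^'+] -->
  \int[sphere_measure]_(u in sphere) h0 u.
Proof.
move=> mh mh0 hh0 hC; apply/cvg_at_rightP => v [v0 cv].
have [N _ NP] : \forall k \near \oo, forall u, sphere u -> `|h (v k) u| <= C.
  have : (v @ \oo) [set e | 0 < e -> forall u, sphere u -> `|h e u| <= C].
    exact: (cv _ hC).
  by apply: (@filterS _ \oo) => k /=; apply.
(* The domination holds only from [N] on, hence the shift. *)
rewrite -(cvg_shiftn N).
have [|||||int0 _ cvgi] := @dominated_convergence _ _ _ sphere_measure sphere
    (@sphere_measurable R n) (fun k u => (h (v (k + N)%N) u)%:E)
    (EFin \o h0) (EFin \o cst C).
- by move=> k; apply/measurable_EFinP; exact: mh.
- exact/measurable_EFinP.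
- apply: aeW => u su; apply: cvg_EFin; first by near=> k.
  have := hh0 u su => /cvg_at_rightP/(_ v (conj v0 cv)).
  by rewrite -(cvg_shiftn N).
- by apply: (@bounded_sphere_integrable _ _ _ `|C|).
- apply: aeW => u k su; rewrite lee_fin; apply: NP => //=.
  exact: leq_addl.
apply: fine_cvg; rewrite fineK//.
exact: (integrable_fin_num sphere_measurable int0).
Unshelve. all: by end_near. Qed.

(** Factoring [1 - t ^+ N] as [1 - t] times a geometric sum leaves that sum, which tends to [N],
    over the difference quotient of [p], which tends to [d]. *)
Lemma geometric_quotient_cvg (F : set_system R) (FF : Filter F) (p : R -> R)
    (d : R) (N : nat) :
  t @[t --> F] --> (1 : R) -> (\forall t \near F, t != 1) ->
  d != 0 -> (p t - 1) / (t - 1) @[t --> F] --> d ->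
  (1 - t ^+ N) / (1 - p t) @[t --> F] --> N%:R / d.
Proof.
move=> F1 Fne d0 pd.
have cN : \sum_(i < N) t ^+ i @[t --> F] --> (N%:R : R).
  rewrite (_ : N%:R = \sum_(i < N) (1 : R)); last first.
    by rewrite sumr_const card_ord.
  apply: cvg_big => [|i _]; first exact: (@add_continuous R^o).
  rewrite -(expr1n R i).
  by apply: (@continuous_cvg _ _ _ _ _ id (@GRing.exp R ^~ i)) => //;
    exact: exprn_continuous.
apply: cvg_trans (cvgM cN (cvgV d0 pd)).
apply: near_eq_cvg; near=> t.
have t1 : t - 1 != 0 by rewrite subr_eq0; near: t.
rewrite /= -[1 - t ^+ N]opprB -[1 - p t]opprB subrX1 invfM invrK.
by rewrite invrN mulrNN [RHS]mulrAC [RHS]mulrC [_ * (t - 1)]mulrC.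
Unshelve. all: by end_near. Qed.

(** * The variation formula along a one-sided filter at 1 *)

Section Abstract.
Variables (K L : set rV) (M : R -> set rV) (phi1 phi2 : R -> R) (d : R).
(** One argument serves both classes: [F] is [1^'-] for [Phi1] and [1^'+] for [Psi1]. *)
Variables (F : set_system R) (FF : Filter F).
Hypotheses (starK : star_body K) (starL : star_body L).
Hypothesis (starM : forall e, 0 < e -> star_body (M e)).
Hypothesis (d0 : d != 0).
Hypotheses (F1 : t @[t --> F] --> (1 : R)) (Fne : \forall t \near F, t != 1).
Hypothesis (phi1_d : (phi1 t - 1) / (t - 1) @[t --> F] --> d).
Hypothesis (phi2_gt0 : forall t, 0 < t -> 0 < phi2 t).
Hypothesis (phi2_cont : forall t, 0 < t -> {for t, continuous phi2}).
Hypothesis (M_eq : forall e u, 0 < e -> sphere u ->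
  1 = phi1 (radial (M e) u / radial K u) +
      e * phi2 (radial (M e) u / radial L u)).
(** Common form of monotonicity: [phi1 t < 1] means [t < 1] with [phi2] increasing for [Phi1], and
    [t > 1] with [phi2] decreasing for [Psi1]. *)
Hypothesis (phi2_le : forall s t, 0 < s -> 0 < t -> phi1 t < 1 ->
  phi2 (t * s) <= phi2 s).
(** Values [phi1 t] close to 1 from below force [t] close to 1 on the side of [F]. This turns a
    uniform estimate on [phi1] of the ratio into one on the ratio. *)
Hypothesis (phi1_basis : forall P : set R, F P -> exists2 t0, phi1 t0 < 1 &
  forall t, 0 < t -> phi1 t0 < phi1 t < 1 -> P t).

Let radial_gt0 (A : set rV) u : star_body A -> sphere u -> 0 < radial A u.
Proof. by move=> [_ + _ _]; exact. Qed.

Let phi2_ratio_continuous :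
  {within sphere, continuous (fun u => phi2 (radial K u / radial L u))}.
Proof.
have [_ K0 _ /subspace_continuousP cK] := starK.
have [_ L0 _ /subspace_continuousP cL] := starL.
apply/subspace_continuousP => u su.
apply: (@continuous_cvg _ _ _ _ _ (fun v => radial K v / radial L v) phi2).
  by apply: phi2_cont; rewrite divr_gt0 ?K0 ?L0.
by apply: cvgM; [exact: cK|apply: cvgV; [rewrite gt_eqF ?L0|exact: cL]].
Qed.

Let phi1_lt1 e u : 0 < e -> sphere u ->
  phi1 (radial (M e) u / radial K u) < 1.
Proof.
move=> e0 su; rewrite [ltRHS](M_eq e0 su) ltrDl.
rewrite mulr_gt0// phi2_gt0// divr_gt0//;
by apply: radial_gt0 => //; exact: starM.
Qed.

(** This bound is independent of [e]: it gives the rate in [M_cvg] and the domination in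
    [quotient_bounded]. *)
Let M_le e u : 0 < e -> sphere u ->
  phi2 (radial (M e) u / radial L u) <= phi2 (radial K u / radial L u).
Proof.
move=> e0 su; have K0 := radial_gt0 starK su; have L0 := radial_gt0 starL su.
have M0 := radial_gt0 (starM e0) su.
have -> : radial (M e) u / radial L u =
    radial (M e) u / radial K u * (radial K u / radial L u).
  by rewrite mulrA divfK// gt_eqF.
by apply: phi2_le; [rewrite divr_gt0|rewrite divr_gt0|exact: phi1_lt1].
Qed.

(* 1 - phi1 (rho_M / rho_K) = e * phi2 (rho_M / rho_L) = O(e) uniformly on the
   sphere. *)
Let M_cvg (P : set R) : F P ->
  \forall e \near 0^'+, forall u, sphere u -> P (radial (M e) u / radial K u).
Proof.
move=> /phi1_basis[t0 t01 t0P].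
have [C phiC] := within_continuous_sphere_bounded phi2_ratio_continuous.
have c1 : 1 - e * C @[e --> 0^'+] --> (1 : R).
  apply: cvg_at_right_filter; rewrite -{2}[1 : R]subr0 -[X in _ - X](mul0r C).
  by apply: cvgB; [exact: cvg_cst|apply: cvgMl; exact: cvg_id].
near=> e; have e0 : 0 < e by near: e; exact: nbhs_right_gt.
have eC : phi1 t0 < 1 - e * C by near: e; exact: (cvgr_gt _ c1).
move=> u su; apply: t0P.
  by rewrite divr_gt0// radial_gt0//; exact: starM.
rewrite phi1_lt1// andbT (lt_le_trans eC)// [X in X - _](M_eq e0 su).
by rewrite -addrA gerDl subr_le0 ler_pM2l// (le_trans (M_le e0 su))// phiC.
Unshelve. all: by end_near. Qed.

Let Q t := (1 - t ^+ n.+1) / (1 - phi1 t).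

Let Q_cvg : Q t @[t --> F] --> n.+1%:R / d.
Proof. exact: geometric_quotient_cvg. Qed.

Let quotientE e u : 0 < e -> sphere u ->
  (radial K u ^+ n.+1 - radial (M e) u ^+ n.+1) / e =
  radial K u ^+ n.+1 * (Q (radial (M e) u / radial K u) *
    phi2 (radial (M e) u / radial L u)).
Proof.
move=> e0 su; have K0 := radial_gt0 starK su.
have M0 := radial_gt0 (starM e0) su; have L0 := radial_gt0 starL su.
set t := radial (M e) u / radial K u; set p := phi2 _.
have p0 : 0 < p by apply: phi2_gt0; rewrite divr_gt0.
have tE : 1 - phi1 t = e * p by rewrite [X in X - _](M_eq e0 su) addrC addKr.
have -> : radial (M e) u = t * radial K u by rewrite divfK ?gt_eqF.
rewrite /Q tE exprMn -{1}[radial K u ^+ _]mul1r -mulrBl invfM.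
rewrite -!mulrA [p^-1 * p]mulVf ?gt_eqF// mulr1 mulrC -!mulrA.
by rewrite [e^-1 * _]mulrC mulrCA.
Qed.

Let quotient_cvg u : sphere u ->
  (radial K u ^+ n.+1 - radial (M e) u ^+ n.+1) / e @[e --> 0^'+] -->
  n.+1%:R / d * (phi2 (radial K u / radial L u) * radial K u ^+ n.+1).
Proof.
move=> su; have K0 := radial_gt0 starK su; have L0 := radial_gt0 starL su.
(* The ratio converges along [F] itself, not merely to 1, as composition with [Q_cvg] demands. *)
have ct : radial (M e) u / radial K u @[e --> 0^'+] --> F.
  by move=> P /M_cvg; apply: (@filterS _ (0^'+)) => e; apply.
have ct1 : radial (M e) u / radial K u @[e --> 0^'+] --> (1 : R).
  exact: cvg_trans ct F1.
have cM : radial (M e) u @[e --> 0^'+] --> radial K u.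
  rewrite -[radial K u]mul1r; apply: cvg_trans (cvgMl ct1).
  apply: near_eq_cvg; near=> e.
  by rewrite divfK// gt_eqF.
rewrite mulrA mulrC.
have cR : radial K u ^+ n.+1 * (Q (radial (M e) u / radial K u) *
    phi2 (radial (M e) u / radial L u)) @[e --> 0^'+] -->
    radial K u ^+ n.+1 * (n.+1%:R / d * phi2 (radial K u / radial L u)).
  apply: cvgMr; apply: cvgM.
    by move=> U /Q_cvg /=; exact: (ct (Q @^-1` U)).
  apply: (@continuous_cvg _ _ _ _ _ (fun e => radial (M e) u / radial L u) phi2).
    by apply: phi2_cont; rewrite divr_gt0.
  exact: cvgMl.
apply: cvg_trans cR; apply: near_eq_cvg; near=> e.
by rewrite quotientE//; near: e; exact: nbhs_right_gt.
Unshelve. all: by end_near. Qed.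

(** The three factors of [quotientE] are bounded separately: the power of the radius by compactness,
    [Q] through its limit and the uniformity of [M_cvg], and [phi2] by [M_le]. *)
Let quotient_bounded : exists C, \forall e \near 0^'+, forall u, sphere u ->
  `|(radial K u ^+ n.+1 - radial (M e) u ^+ n.+1) / e| <= C.
Proof.
have [m [B [m0 mB]]] := radial_bounds starK.
have [C phiC] := within_continuous_sphere_bounded phi2_ratio_continuous.
(* The added 1 is slack: it puts the limit of [Q] strictly inside the bound. *)
pose q := `|n.+1%:R / d| + 1.
exists (B ^+ n.+1 * (q * C)).
have FQ : F [set t | `|Q t| <= q].
  by apply: (@cvgr_norm_le R R^o _ F _ Q _ Q_cvg); rewrite ltrDl.
have MQ := M_cvg FQ.
near=> e.
have Qe v : sphere v -> `|Q (radial (M e) v / radial K v)| <= q.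
  by move: v; near: e; exact: MQ.
move=> u su; have e0 : 0 < e by near: e; exact: nbhs_right_gt.
have /andP[mK KB] := mB u su; have K0 : 0 < radial K u := lt_le_trans m0 mK.
have p0 : 0 < phi2 (radial (M e) u / radial L u).
  by apply: phi2_gt0; rewrite divr_gt0// radial_gt0//; exact: starM.
rewrite quotientE// normrM normrX normrM (gtr0_norm K0) (gtr0_norm p0).
apply: ler_pM.
- by rewrite exprn_ge0// ltW.
- by rewrite mulr_ge0// ltW.
- by rewrite lerXn2r// nnegrE ltW// (lt_le_trans K0).
apply: ler_pM; [exact: normr_ge0|exact: ltW|exact: Qe|].
by rewrite (le_trans (M_le e0 su))// phiC.
Unshelve. all: by end_near. Qed.

Lemma volume_variation :
  (volume K - volume (M e)) / (n.+1%:R * e) @[e --> 0^'+] -->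
  d^-1 * (n.+1%:R^-1 * \int[sphere_measure]_(u in sphere)
     (phi2 (radial K u / radial L u) * radial K u ^+ n.+1)).
Proof.
have mS := @sphere_measurable R n.
have mX (A : set rV) : star_body A ->
    measurable_fun (sphere : set borel) (fun u => radial A u ^+ n.+1).
  by move=> sA; apply: measurable_funX; exact: radial_measurable.
have mphi : measurable_fun (sphere : set borel)
    (fun u => phi2 (radial K u / radial L u) * radial K u ^+ n.+1).
  apply: measurable_funM; last exact: mX.
  exact: within_continuous_measurable.
have [C hC] := quotient_bounded.
have mq e : 0 < e -> measurable_fun (sphere : set borel)
    (fun u => (radial K u ^+ n.+1 - radial (M e) u ^+ n.+1) / e).
  move=> e0; apply: measurable_funM => //.
  by apply: measurable_funB; apply: mX => //; exact: starM.
have mlim : measurable_fun (sphere : set borel) (fun u => n.+1%:R / d *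
    (phi2 (radial K u / radial L u) * radial K u ^+ n.+1)).
  exact: measurable_funM.
have := cvg_Rintegral_sphere mq mlim quotient_cvg hC.
have [m [B [m0 mB]]] := radial_bounds starK.
have [D phiD] := within_continuous_sphere_bounded phi2_ratio_continuous.
rewrite RintegralZl//; last first.
  apply: (@bounded_sphere_integrable _ _ _ (D * B ^+ n.+1)) => // u su.
  have /andP[mK KB] := mB u su; have K0 : 0 < radial K u := lt_le_trans m0 mK.
  have p0 : 0 < phi2 (radial K u / radial L u).
    by apply: phi2_gt0; rewrite divr_gt0// radial_gt0.
  rewrite normrM normrX (gtr0_norm K0) (gtr0_norm p0).
  apply: ler_pM; [exact: ltW|by rewrite exprn_ge0// ltW|exact: phiD|].
  by rewrite lerXn2r// nnegrE ltW// (lt_le_trans K0).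
move=> cI.
have n0 : n.+1%:R != 0 :> R by rewrite pnatr_eq0.
set J := Rintegral _ _ _ in cI *.
(* One factor [n.+1%:R^-1] comes from the polar formula for the volume, the other from the
   denominator [n.+1%:R * e]. *)
rewrite (_ : d^-1 * _ = n.+1%:R^-1 ^+ 2 * (n.+1%:R / d * J)); last first.
  by rewrite expr2 !mulrA mulfVK// -!mulrA mulrCA.
have c2 : n.+1%:R^-1 ^+ 2 * \int[sphere_measure]_(u in sphere)
    ((radial K u ^+ n.+1 - radial (M e) u ^+ n.+1) / e) @[e --> 0^'+] -->
    n.+1%:R^-1 ^+ 2 * (n.+1%:R / d * J) by exact: cvgMr.
apply: cvg_trans c2.
apply: near_eq_cvg.
have : \forall e \near (0 : R)^'+, 0 < e by exact: nbhs_right_gt.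
apply: filterS => e e0.
have iK := radialX_integrable starK; have iM := radialX_integrable (starM e0).
under eq_Rintegral do rewrite mulrC.
rewrite RintegralZl//; last exact: (integrableB mS iK iM).
rewrite RintegralB// !volume_star_body//; last exact: starM.
by rewrite -mulrBr invfM expr2 -!mulrA; congr (_ * _); rewrite mulrA mulrC.
Qed.

End Abstract.

End Variation.

Section Psi1Facts.
Context {R : realType}.
Variable phi : R -> R.
Hypothesis Pphi : Psi1 phi.

Lemma Psi1_lt s t : 0 < s -> s < t -> phi t < phi s.
Proof.
move=> s0 st; have t0 := lt_trans s0 st.
have [_ [psi [_ _ inc _ _] psiE]] := Pphi.
rewrite -[s]invrK -[t]invrK -!psiE ?invr_gt0// inc ?invr_ge0 ?(ltW t0)//.
by rewrite ltf_pV2.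
Qed.

Lemma Psi1_1 : phi 1 = 1.
Proof.
have [_ [psi [_ _ _ _ psi1] psiE]] := Pphi.
by rewrite -[1 in LHS]invr1 -psiE.
Qed.

Lemma Psi1_continuous t : 0 < t -> {for t, continuous phi}.
Proof.
move=> t0; have [_ [psi Ppsi psiE]] := Pphi.
have ct : psi s^-1 @[s --> t] --> phi t.
  rewrite -[t in phi t]invrK -psiE ?invr_gt0//.
  apply: (@continuous_cvg _ _ _ _ _ (fun s : R => s^-1) psi).
    by apply: Phi1_continuous => //; rewrite invr_gt0.
  by apply: cvgV; [rewrite gt_eqF|exact: cvg_id].
apply: cvg_trans ct; apply: near_eq_cvg; near=> s.
rewrite psiE ?invrK// invr_gt0.
by near: s; exact: lt_nbhsr.
Unshelve. all: by end_near. Qed.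

End Psi1Facts.

(** The dimension is [n.+1], hence positive. Convergence is asserted beside the value because [lim]
    of a divergent family is a default. When [d = 0] the factor [(1 - t ^+ n.+1) / (1 - phi1 t)] is
    unbounded near 1 and the limit is infinite, whence [d != 0]. *)
Theorem theorem3p1 (R : realType) (n : nat) (K L : set 'rV[R]_n.+1)
    (starK : star_body K) (starL : star_body L) :
  (forall (phi1 phi2 : R -> R) (d : R),
     Phi1 phi1 -> Phi1 phi2 ->
     is_left_derivative phi1 1 d -> d != 0 ->
     cvg ((volume K - volume (orlicz_sum eps phi1 phi2 K L)) / (n.+1%:R * eps)
            @[eps --> 0^'+]) /\
     d * lim ((volume K - volume (orlicz_sum eps phi1 phi2 K L))
                / (n.+1%:R * eps) @[eps --> 0^'+])
     = n.+1%:R^-1 * \int[sphere_measure]_(u in sphere)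
                     (phi2 (radial K u / radial L u) * radial K u ^+ n.+1)) /\
  (forall (phi1 phi2 : R -> R) (d : R),
     Psi1 phi1 -> Psi1 phi2 ->
     is_right_derivative phi1 1 d -> d != 0 ->
     cvg ((volume K - volume (orlicz_sum eps phi1 phi2 K L)) / (n.+1%:R * eps)
            @[eps --> 0^'+]) /\
     d * lim ((volume K - volume (orlicz_sum eps phi1 phi2 K L))
                / (n.+1%:R * eps) @[eps --> 0^'+])
     = n.+1%:R^-1 * \int[sphere_measure]_(u in sphere)
                     (phi2 (radial K u / radial L u) * radial K u ^+ n.+1)).
Proof.
have concl (f : R -> R) (d I : R) : d != 0 -> f e @[e --> 0^'+] --> d^-1 * I ->
    cvg (f e @[e --> 0^'+]) /\ d * lim (f e @[e --> 0^'+]) = I.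
  move=> d0 cf; split; first by apply/cvg_ex; exists (d^-1 * I).
  by rewrite (cvg_lim _ cf)// mulVKf.
split=> phi1 phi2 d P1 P2 phi1_d d0; apply: concl => //.
- have [_ _ inc1 _ phi11] := P1.
  apply: (@volume_variation _ _ _ _ _ phi1 phi2 d 1^'-) => //.
  + by move=> e e0; exact: (orlicz_sum_Phi1 starK starL e0 P1 P2).1.
  + by apply: cvg_at_left_filter; exact: cvg_id.
  + by near=> t; rewrite lt_eqF//; near: t; exact: nbhs_left_lt.
  + by move: phi1_d; rewrite /is_left_derivative phi11.
  + by move=> t; exact: Phi1_gt0.
  + by move=> t; exact: Phi1_continuous.
  + by move=> e u e0; exact: (orlicz_sum_Phi1 starK starL e0 P1 P2).2.
  + move=> s t s0 t0 t1; apply: Phi1_le => //; first by rewrite mulr_ge0// ltW.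
    rewrite ger_pMl// leNgt; apply/negP => /ltW /(Phi1_le P1 ler01).
    by rewrite phi11 leNgt t1.
  (* With this [t0], the inequalities [phi1 t0 < phi1 t < 1] give [1 - e < t < 1]; the maximum with
     0 keeps [t0] where [phi1] is increasing. *)
  + move=> P /nbhs_ballP[e /= e0 eP]; exists (Num.max 0 (1 - e)).
      by rewrite -[ltRHS]phi11 inc1 ?le_max ?lexx// gt_max ltr01 gtrBl.
    move=> t t0 /andP[t_gt t_lt].
    have t1 : t < 1.
      rewrite ltNge; apply/negP => /(Phi1_le P1 ler01).
      by rewrite phi11 leNgt t_lt.
    apply: (eP t) => //=; rewrite /ball/= gtr0_norm ?subr_gt0// ltrBlDl -ltrBlDr.
    rewrite ltNge; apply/negP => te; move: t_gt; rewrite ltNge => /negP; apply.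
    by apply: Phi1_le => //; [exact: ltW|rewrite le_max te orbT].
- have inc1 := Psi1_lt P1; have inc2 := Psi1_lt P2; have phi11 := Psi1_1 P1.
  apply: (@volume_variation _ _ _ _ _ phi1 phi2 d 1^'+) => //.
  + by move=> e e0; exact: (orlicz_sum_Psi1 starK starL e0 P1 P2).1.
  + by apply: cvg_at_right_filter; exact: cvg_id.
  + by near=> t; rewrite gt_eqF//; near: t; exact: nbhs_right_gt.
  + by move: phi1_d; rewrite /is_right_derivative phi11.
  + by have [] := P2.
  + by move=> t; exact: Psi1_continuous.
  + by move=> e u e0; exact: (orlicz_sum_Psi1 starK starL e0 P1 P2).2.
  + move=> s t s0 t0 t1; rewrite ltW// inc2// ltr_pMl//.
    rewrite ltNge le_eqVlt; apply/negP => /predU1P[t1E|/(inc1 _ _ t0)].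
      by move: t1; rewrite t1E phi11 ltxx.
    by rewrite phi11 ltNge ltW.
  (* As [phi1] decreases, [phi1 (1 + e) < phi1 t < 1] gives [1 < t < 1 + e]. *)
  + move=> P /nbhs_ballP[e /= e0 eP]; exists (1 + e).
      by rewrite -[ltRHS]phi11 inc1 ?ltrDl.
    move=> t t0 /andP[t_gt t_lt].
    have t1 : 1 < t.
      rewrite ltNge le_eqVlt; apply/negP => /predU1P[tE|/(inc1 _ _ t0)].
        by move: t_lt; rewrite tE phi11 ltxx.
      by rewrite phi11 ltNge ltW.
    apply: (eP t) => //=; rewrite /ball/= ltr0_norm ?subr_lt0// opprB ltrBlDl.
    rewrite ltNge le_eqVlt; apply/negP => /predU1P[te|te].
      by move: t_gt; rewrite te ltxx.
    have := inc1 (1 + e) t; rewrite addr_gt0// => /(_ isT te).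
    by rewrite ltNge ltW.
Unshelve. all: by end_near. Qed.
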